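(* Let $\Gamma$ be a metric graph of genus $g$. Every divisor $D\in\operatorname{Div}^{g-1}(\Gamma)$ is linearly equivalent to an orientable divisor on $\Gamma$. More precisely, if $G$ is a model for $(\Gamma,D)$, then $D$ is linearly equivalent to a divisor $D'$ on $\Gamma$ such that $G$ is a semi-model for $(\Gamma,D')$ and $D'_G$ is orientable on $G_{D'}$.
   Context: A metric graph $\Gamma$ arises from a weighted graph model $G$ (finite connected graph without loops, positive edge lengths) by gluing segments; genus $g=|E(G)|-|V(G)|+1$. $R(\Gamma)$ is the group of continuous piecewise affine integer-slope functions; $\Delta(f)=\sum_p\sigma_p(f)(p)$ with $-\sigma_p(f)$ the sum of slopes of $f$ in all tangent directions at $p$; $D\sim D'$ iff $D-D'=\Delta(f)$. An orientation $\mathcal O$ of $\Gamma$ is an orientation of the edges of some model, up to refinement; $\mathrm{indeg}_{\mathcal O}(p)$ counts tangent directions at $p$ oriented toward $p$; $D$ is orientable if $D=\sum_p(\mathrm{indeg}_{\mathcal O}(p)-1)(p)$ for some $\mathcal O$. A model for $(\Gamma,D)$ is a model whose vertex set contains $\mathrm{Supp}(D)$. A model $G$ is a semi-model for $(\Gamma,D')$ if each open edge $e^\circ$ of $G$ meets $\mathrm{Supp}(D')$ in either nothing or a single point $p$ with $D'(p)=1$. Then $G_{D'}$ is the graph on $V(G)$ obtained by deleting the edges whose interior meets $\mathrm{Supp}(D')$, $D'_G=\sum_{p\in V(G)}D'(p)(p)$, and a divisor $E$ on a finite graph $H$ is orientable if some orientation of $H$ has $E(v)=\mathrm{indeg}(v)-1$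 at every vertex $v$. *)

(* Defs.v *)
From HB Require Import structures.
From mathcomp Require Import all_boot all_order all_algebra.
From mathcomp Require Import finmap.
From mathcomp Require Import all_classical all_reals.
From mathcomp Require Import topology.

Set Implicit Arguments.
Unset Strict Implicit.
Unset Printing Implicit Defensive.

Import Order.TTheory GRing.Theory Num.Theory.

Local Open Scope classical_set_scope.
Local Open Scope ring_scope.

(* Finite multigraphs.  The direction from [src e] to [tgt e] carries no
   meaning: it only fixes a parametrization of the undirected edge [e]. *)
Record fgraph := FGraph {
  vert : finType;
  edge : finType;
  src : edge -> vert;
  tgt : edge -> vert }.

Definition adj (G : fgraph) : rel (vert G) :=
  fun u v => [exists e : edge G, ((src e == u) && (tgt e == v))
                              || ((src e == v) && (tgt e == u))].

Definition connected_graph (G : fgraph) : Prop :=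
  (0 < #|vert G|)%N /\ forall u v : vert G, connect (@adj G) u v.

(* [o e = true] orients [e] from [src e] to [tgt e]. *)
Definition orientation (G : fgraph) := edge G -> bool.

Definition edge_head (G : fgraph) (o : orientation G) (e : edge G) : vert G :=
  if o e then tgt e else src e.

Definition indeg (G : fgraph) (o : orientation G) (v : vert G) : nat :=
  #|[pred e : edge G | edge_head o e == v]|.

Definition orientable_on (G : fgraph) (E : vert G -> int) : Prop :=
  exists o : orientation G, forall v, E v = (indeg o v)%:Z - 1.

Arguments orientable_on G E : clear implicits.

Record wgraph (R : realType) := WGraph {
  wgraph_graph :> fgraph;
  wgraph_connected : connected_graph wgraph_graph;
  wgraph_loopless : forall e : edge wgraph_graph, src e != tgt e;
  len : edge wgraph_graph -> R;
  len_gt0 : forall e, 0 < len e }.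

(* The gluing (quotient) metric: the distance between two points is the
   infimum of the total lengths of the chains joining them, where each link
   (e, s, t) of a chain moves inside the closed segment [0, len e] from
   parameter s to parameter t. *)
Section Gluing.
Context {R : realType} (G : wgraph R) {T : Type} (seg : edge G -> R -> T).

Fixpoint chain (x : T) (w : seq (edge G * R * R)) (y : T) : Prop :=
  if w is (e, s, t) :: w' then
    [/\ 0 <= s <= len e, 0 <= t <= len e, seg e s = x & chain (seg e t) w' y]
  else x = y.

Definition chain_length (w : seq (edge G * R * R)) : R :=
  \sum_(l <- w) `|l.1.2 - l.2|.

Definition gluing_dist (x y : T) : R :=
  inf [set chain_length w | w in [set w | chain x w y]].

End Gluing.

(* A model of the metric space T: a weighted graph G together with an
   isometry onto T from the space glued out of the segments [0, len e].  The
   isometry is given by the images [pt v] of the vertices and the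
   parametrizations [seg e] of the closed edges; the values of [seg e]
   outside of [0, len e] are irrelevant. *)
Record model {R : realType} (T : metricType R) := Model {
  model_graph :> wgraph R;
  pt : vert model_graph -> T;
  seg : edge model_graph -> R -> T;
  pt_inj : injective pt;
  seg_src : forall e, seg e 0 = pt (src e);
  seg_tgt : forall e, seg e (len e) = pt (tgt e);
  seg_vert : forall e t v, 0 < t < len e -> seg e t <> pt v;
  seg_inj : forall e t e' t', 0 < t < len e -> 0 < t' < len e' ->
    seg e t = seg e' t' -> e = e' /\ t = t';
  model_cover : forall x : T, (exists v, pt v = x) \/
    (exists e t, 0 < t < len e /\ seg e t = x);
  model_dist : forall x y : T, mdist x y = gluing_dist seg x y }.

Record metricGraph (R : realType) := MetricGraph {
  space :> metricType R;
  space_model : inhabited (model space) }.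

(* The right-hand side does not depend on the model G. *)
Definition has_genus {R : realType} (Gam : metricGraph R) (g : int) : Prop :=
  exists G : model Gam, g = #|edge G|%:Z - #|vert G|%:Z + 1.

Definition divisor {R : realType} (Gam : metricGraph R) :=
  {fsfun Gam -> int with 0}.

Definition deg {R : realType} {Gam : metricGraph R} (D : divisor Gam) : int :=
  \sum_(p <- finsupp D) D p.

Definition supp {R : realType} {Gam : metricGraph R} (D : divisor Gam) :
  set Gam := [set p | D p != 0].

Section OnModel.
Context {R : realType} {Gam : metricGraph R} (G : model Gam).

(* The tangent directions at p are encoded as pairs (e, b): p lies on the
   closed edge e, and one can leave p inside e with increasing parameter
   (b = true) or with decreasing parameter (b = false).  As G has no loops,
   p has at most one parameter on e.  An interior point of an edge has two
   tangent directions, a vertex has one for each incident edge. *)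
Definition tangent (p : Gam) : pred (edge G * bool) :=
  fun d => `[< exists t, [/\ 0 <= t <= len d.1, seg d.1 t = p &
                 if d.2 then t < len d.1 else 0 < t] >].

(* The direction (e, b) leads away from p, so it is oriented toward p when o
   orients e the other way. *)
Definition indeg_at (o : orientation G) (p : Gam) : nat :=
  #|[pred d : edge G * bool | tangent p d && (o d.1 != d.2)]|.

(* f is affine with integer slope s e on each closed edge e; in particular f
   is continuous. *)
Definition affine_on (f : Gam -> R) (s : edge G -> int) : Prop :=
  forall e t, 0 <= t <= len e -> f (seg e t) = f (seg e 0) + (s e)%:~R * t.

Definition out_slope (s : edge G -> int) (d : edge G * bool) : int :=
  if d.2 then s d.1 else - s d.1.

Definition sigma (s : edge G -> int) (p : Gam) : int :=
  - \sum_(d | tangent p d) out_slope s d.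

Definition open_edge (e : edge G) : set Gam :=
  [set seg e t | t in [set t | 0 < t < len e]].

Definition model_for (D : divisor Gam) : Prop := supp D `<=` range (@pt _ _ G).

Definition semi_model (D : divisor Gam) : Prop :=
  forall e : edge G, open_edge e `&` supp D = set0 \/
    exists p, open_edge e `&` supp D = [set p] /\ D p = 1.

(* G_D *)
Definition del_graph (D : divisor Gam) : fgraph :=
  @FGraph (vert G) {e : edge G | `[< open_edge e `&` supp D = set0 >]}
    (fun e => src (val e)) (fun e => tgt (val e)).

(* D_G *)
Definition restr_div (D : divisor Gam) : vert (del_graph D) -> int :=
  fun v => D (pt v).

End OnModel.

Arguments restr_div {R Gam} G D v.

(* f belongs to R(Gam) and Delta(f) = E: a function is piecewise affine when
   it is affine on the edges of some model, and its slopes may be read off on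
   any such model. *)
Definition has_Delta {R : realType} {Gam : metricGraph R} (f : Gam -> R)
    (E : Gam -> int) : Prop :=
  exists (G : model Gam) (s : edge G -> int),
    affine_on f s /\ forall p, E p = sigma s p.

Definition lin_equiv {R : realType} {Gam : metricGraph R}
    (D D' : divisor Gam) : Prop :=
  exists f : Gam -> R, has_Delta f (fun p => D p - D' p).

Definition orientable {R : realType} {Gam : metricGraph R}
    (D : divisor Gam) : Prop :=
  exists (G : model Gam) (o : orientation G),
    forall p, D p = (indeg_at o p)%:Z - 1.

(* Main.v *)
From mathcomp Require Import all_boot all_order all_algebra.
From mathcomp Require Import finmap.
From mathcomp Require Import all_classical all_reals.
From mathcomp Require Import topology normedtype derive.
From mathcomp Require Import ring lra zify.
Require Import Defs.

(** Let G be a model for (Gam, D). A function f on the vertices of G extends to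
    each edge as a convex function whose slopes are the integers around the mean
    slope a of f along the edge: it is affine if a is an integer, and otherwise
    has a single break, where [D - Delta f] has a chip of multiplicity 1. So G
    is a semi-model for [D' = D - Delta f], and [D'(v)] is [D v] plus the sum of
    the floors of the mean slopes leaving v.

    Choose f minimizing the coercive convex energy
    [sum_e len e * psi (a_e) - sum_v c_v f v], where [psi' = floor + 1/2] and
    [c_v = D v + 1 - valence v / 2]. That the energy does not decrease in the
    direction of minus the indicator of a set S of vertices says that
    [sum_(v in S) (D' v + 1)] is at least the number of edges of G_D' inside S;
    by Hakimi's theorem this makes D'_G orientable on G_D'.

    The degree hypothesis is about some model, but [|E| - |V|] is the same for
    all of them: it is half the sum over the points p of [valence p - 2], and
    [valence p] is the number of points at a small distance r from p. *)

Set Implicit Arguments.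
Unset Strict Implicit.
Unset Printing Implicit Defensive.

Import Order.TTheory GRing.Theory Num.Theory.
Import numFieldNormedType.Exports.

Local Open Scope ring_scope.

(** * Orientations with prescribed indegrees *)

Section Hakimi.
Variable H : fgraph.
Implicit Types (A : {set edge H}) (S T : {set vert H}) (m : vert H -> int).

Definition inner A S := [set e in A | (src e \in S) && (tgt e \in S)].

Lemma innerE A S : #|inner A S|%:Z =
  \sum_(e in A) ((src e \in S) && (tgt e \in S))%:R :> int.
Proof.
rewrite /inner -sum1_card -natz natr_sum.
rewrite big_mkcond [RHS]big_mkcond /=.
by apply: eq_bigr => e _; rewrite inE; case: (e \in A) => //=; case: (_ && _).
Qed.

(** Edge by edge, lying inside a set is supermodular; the edge [e0], joining [S :\: T] to [T :\: S],
    lies inside the union but not inside the other three sets, which gives the extra 1. *)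
Lemma inner_supermodular A S T e0 : e0 \in A ->
  src e0 \in S -> tgt e0 \notin S -> src e0 \notin T -> tgt e0 \in T ->
  #|inner A S|%:Z + #|inner A T|%:Z + 1 <=
    #|inner A (S :|: T)|%:Z + #|inner A (S :&: T)|%:Z.
Proof.
move=> e0A sS tS sT tT; rewrite !innerE.
rewrite (bigD1 e0)//= [X in _ + X + 1](bigD1 e0)//= [X in _ <= X + _](bigD1 e0)//=.
rewrite [X in _ <= _ + X](bigD1 e0)//= !inE sS (negPf tS) (negPf sT) tT /=.
rewrite !add0r [1 + _]addrC [leRHS]addrAC lerD2r -!big_split /=.
apply: ler_sum => e _; rewrite !inE.
by case: (src e \in S); case: (src e \in T); case: (tgt e \in S); case: (tgt e \in T).
Qed.

Lemma sum_setUI m S T : \sum_(v in S) m v + \sum_(v in T) m v =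
  \sum_(v in S :|: T) m v + \sum_(v in S :&: T) m v.
Proof.
rewrite [\sum_(v in S) _]big_mkcond [\sum_(v in T) _]big_mkcond.
rewrite [\sum_(v in _ :|: _) _]big_mkcond [\sum_(v in _ :&: _) _]big_mkcond.
rewrite -!big_split /=; apply: eq_bigr => v _; rewrite !inE.
by case: (v \in S); case: (v \in T) => /=; ring.
Qed.

Definition hakimi m A := (forall S, #|inner A S|%:Z <= \sum_(v in S) m v).

Definition sub1 m (u : vert H) := fun v => m v - (v == u)%:R.

Lemma sum_sub1 m u S : \sum_(v in S) sub1 m u v = \sum_(v in S) m v - (u \in S)%:R.
Proof.
rewrite sumrB; congr (_ - _).
rewrite big_mkcond /= (bigD1 u)//= big1 ?addr0; last first.
  by move=> v /negPf ->; case: ifP.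
by rewrite eqxx; case: ifP.
Qed.

Lemma inner_D1 A S e0 : e0 \in A -> #|inner A S|%:Z =
  ((src e0 \in S) && (tgt e0 \in S))%:R + #|inner (A :\ e0) S|%:Z.
Proof.
move=> e0A; rewrite !innerE (bigD1 e0)//=; congr (_ + _).
by apply: eq_bigl => e; rewrite !inE andbC.
Qed.

(** Lowering [m] at [u] costs 1 on the right only if [u] is in [S]; deleting [e0] then costs 1 on
    the left too, unless an end of [e0] is outside [S], and there the slack of a non-tight set
    suffices. *)
Lemma hakimi_sub1 m A e0 u : hakimi m A -> e0 \in A ->
  (forall S, u \in S -> ~~ ((src e0 \in S) && (tgt e0 \in S)) ->
     #|inner A S|%:Z != \sum_(v in S) m v) ->
  hakimi (sub1 m u) (A :\ e0).
Proof.
move=> hm e0A hu S; have := hm S; have := hu S; rewrite sum_sub1 (inner_D1 S e0A).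
case: (u \in S) => /=; case: (_ && _) => /=; rewrite ?subr0; try lia.
Qed.

(* Orienting an edge toward one of its ends fails only because of a tight set
   containing that end but not the other one; two such tight sets, one for
   each end, would contradict supermodularity. *)
Lemma hakimi_orientation m A : hakimi m A -> \sum_v m v = #|A|%:Z ->
  exists o : orientation H, forall v,
    m v = #|[set e in A | edge_head o e == v]|%:Z.
Proof.
have [n] := ubnP #|A|; elim: n m A => // n IH m A ltAn hm sm.
have [A0|[e0 e0A]] := set_0Vmem A.
  exists (fun=> true) => v; rewrite A0.
  have m_ge0 u : 0 <= m u.
    by have := hm [set u]; rewrite big_set1; lia.
  have /psumr_eq0P : \sum_v m v = 0 by rewrite sm A0 cards0.
  move=> /(_ (fun u _ => m_ge0 u)) -> //.
  rewrite (_ : [set e in _ | _] = finset.set0) ?cards0//.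
  by apply/setP => e; rewrite !inE.
have cA : #|A| = (#|A :\ e0|).+1 by rewrite (cardsD1 e0 A) e0A.
suff [b hb] : exists b : bool, hakimi (sub1 m (if b then tgt e0 else src e0)) (A :\ e0).
  have [] := IH _ (A :\ e0) _ hb.
  - by move: ltAn; rewrite cA.
  - have := sum_sub1 m (if b then tgt e0 else src e0) [set: vert H].
    rewrite inE (eq_bigl predT) => [->|v]; last by rewrite inE.
    rewrite (eq_bigl predT) => [|v]; last by rewrite inE.
    by rewrite sm cA; lia.
  move=> o ho; exists (fun e => if e == e0 then b else o e) => v.
  have := ho v; rewrite /sub1 => /eqP; rewrite subr_eq => /eqP ->.
  rewrite (cardsD1 e0 [set e in A | _]) !inE e0A /= {2}/edge_head eqxx eq_sym.
  rewrite PoszD addrC; congr (_ + _); last first.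
    congr (Posz _); apply: eq_card => e; rewrite !inE /edge_head.
    by case: (e =P e0).
  by case: (_ == _).
apply: contrapT => nb.
have tight u w : (u == src e0) && (w == tgt e0) || (u == tgt e0) && (w == src e0) ->
   ~ hakimi (sub1 m u) (A :\ e0) ->
   exists S, [/\ u \in S, w \notin S & #|inner A S|%:Z = \sum_(v in S) m v].
  move=> huw nh; apply: contrapT => nS; apply: nh; apply: hakimi_sub1 => // S uS nst.
  apply/negP => /eqP tS; apply: nS; exists S; split=> //.
  by case/orP: huw nst => /andP[/eqP <- /eqP <-]; rewrite uS ?andbT.
have [||S [sS tS eS]] := tight (src e0) (tgt e0); first by rewrite !eqxx.
  by move=> h; apply: nb; exists false.
have [||T [tT sT eT]] := tight (tgt e0) (src e0); first by rewrite !eqxx orbT.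
  by move=> h; apply: nb; exists true.
have := inner_supermodular e0A sS tS sT tT.
have := hm (S :|: T); have := hm (S :&: T).
by have := sum_setUI m S T; rewrite -eS -eT; lia.
Qed.

End Hakimi.

(** * Energy of a function on the vertices *)

Section Psi.
Variable R : realType.
Implicit Types (x y : R) (n : int).

(* The convex even function with derivative [floor x + 1/2] off the integers. *)
Definition psi x : R :=
  let n := (Num.floor x)%:~R in (n + 2^-1) * x - n * (n + 1) / 2.

Lemma psi_itv n x : n%:~R <= x <= n%:~R + 1 ->
  psi x = (n%:~R + 2^-1) * x - n%:~R * (n%:~R + 1) / 2.
Proof.
move=> /andP[nx]; rewrite le_eqVlt => /orP[/eqP xE|xn].
  have -> : x = (n + 1)%:~R by rewrite rmorphD.
  by rewrite /psi intrKfloor rmorphD /=; field.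
rewrite /psi; suff -> : Num.floor x = n by [].
by apply/eqP; rewrite floor_eq rmorphD /= nx xn.
Qed.

(** Convexity of [psi]: with [m] the floor of [x], the gap is [(m - n) * (x - (m + n + 1) / 2)],
    whose factors never have opposite signs. *)
Lemma psi_ge n x : (n%:~R + 2^-1) * x - n%:~R * (n%:~R + 1) / 2 <= psi x.
Proof.
rewrite /psi; have := floor_itv x; rewrite rmorphD /=.
set m := Num.floor x => /andP[mx xm].
have [mn|nm|->] := ltgtP m n => //.
- have : m + 1 <= n by lia.
  rewrite -(ler_int R) rmorphD /= => h.
  nra.
- have : n + 1 <= m by lia.
  rewrite -(ler_int R) rmorphD /= => h.
  nra.
Qed.

Lemma psi0 : psi 0 = 0.
Proof. by rewrite (@psi_itv 0) ?mulr0z ?lexx ?add0r ?ler01// mulr0 !mul0r subr0. Qed.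

Lemma psiD x d : 0 <= d -> x + d <= (Num.floor x)%:~R + 1 ->
  psi (x + d) = psi x + d * ((Num.floor x)%:~R + 2^-1).
Proof.
move=> d0 xd; have /andP[nx xn] := floor_itv x; rewrite rmorphD /= in xn.
rewrite (@psi_itv (Num.floor x)) ?xd ?andbT ?(le_trans nx) ?lerDl//.
by rewrite (@psi_itv (Num.floor x) x) ?nx ?(ltW xn)//; field.
Qed.

Lemma psiN x : psi (- x) = psi x.
Proof.
have /andP[nx xn] := floor_itv x; rewrite rmorphD /= in xn.
rewrite (@psi_itv (- Num.floor x - 1)); last first.
  by rewrite rmorphB rmorphN /=; lra.
by rewrite (@psi_itv (Num.floor x) x) ?nx ?(ltW xn)// rmorphB rmorphN /=; field.
Qed.

(** Superlinear growth, the source of coercivity: [n] may be arbitrarily large. *)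
Lemma psi_ge_norm (n : nat) x :
  (n%:R + 2^-1) * `|x| - n%:R * (n%:R + 1) / 2 <= psi x.
Proof.
have /orP[x0|x0] := le_total 0 x.
  by rewrite ger0_norm//; exact: (psi_ge n).
by rewrite ler0_norm// -psiN; exact: (psi_ge n).
Qed.

(** [floor x + 1/2] is a subgradient at [x] and is at most [|x| + 1] in absolute value. *)
Lemma psi_subgradient x y : psi x - psi y <= (`|x| + 1) * `|x - y|.
Proof.
have h := psi_ge (Num.floor x) y.
have /andP[nx xn] := floor_itv x; rewrite rmorphD /= in xn.
set n := (Num.floor x)%:~R in nx xn h *.
have hx : psi x = (n + 2^-1) * x - n * (n + 1) / 2 by [].
apply: (@le_trans _ _ ((n + 2^-1) * (x - y))); first by rewrite hx; lra.
apply: (le_trans (ler_norm _)); rewrite normrM ler_wpM2r//.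
by rewrite ler_norml; have := ler_norm x; have := ler_norm (- x); rewrite normrN; lra.
Qed.

Lemma psi_continuous : continuous psi.
Proof.
move=> x; apply/cvgrPdist_le => e e0.
have k0 : 0 < `|x| + 2 by rewrite ltr_wpDl.
near=> y.
have xy1 : `|x - y| <= 1 by near: y; exact: cvgr_dist_le.
have xye : `|x - y| <= e / (`|x| + 2).
  by near: y; apply: cvgr_dist_le => //; exact: divr_gt0.
have ky : `|y| <= `|x| + 1.
  rewrite -[y](subKr x); apply: (le_trans (ler_normB _ _)); lra.
have h1 := psi_subgradient x y; have h2 := psi_subgradient y x.
rewrite (distrC y x) in h2.
have : `|psi x - psi y| <= (`|x| + 2) * `|x - y|.
  by rewrite ler_norml; have := normr_ge0 (x - y); nra.
move=> /le_trans; apply; rewrite mulrC -ler_pdivlMr//.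
Unshelve. all: by end_near. Qed.

End Psi.

Section Energy.
Variables (R : realType) (G : wgraph R).
Implicit Types (D : vert G -> int) (f h : vert G -> R) (e : edge G).

Definition slope f e : R := (f (tgt e) - f (src e)) / len e.

(** The half-sums over the edges add up to [valence v / 2] at each vertex: they are the part
    [- valence v / 2] of [c_v], distributed over the edges. *)
Definition energy D f : R :=
  \sum_e (len e * psi (slope f e) + (f (src e) + f (tgt e)) / 2)
    - \sum_v (D v + 1)%:~R * f v.

Definition integral_edges f : {set edge G} := [set e | slope f e \is a Num.int].

(* The value at v, plus 1, of the divisor [D - Delta f], when [f] is extended
   to each edge as a convex function whose slopes are the integers around
   [slope f e]. *)
Definition fired D f v : int :=
  D v + 1 + \sum_(e | src e == v) Num.floor (slope f e)
          + \sum_(e | tgt e == v) Num.floor (- slope f e).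

Lemma path_variation f (Y : R) u p : (forall e, `|f (tgt e) - f (src e)| <= Y) ->
  path (@adj G) u p -> `|f (last u p) - f u| <= (size p)%:R * Y.
Proof.
move=> hY; elim: p u => [|v p IH] u /=; first by rewrite subrr normr0 mul0r.
move=> /andP[uv /IH h].
have uvY : `|f v - f u| <= Y.
  move: uv => /existsP[e /orP[] /andP[/eqP <- /eqP <-]] //.
  by rewrite distrC.
rewrite -(subrKA (f v)) -natr1 mulrDl mul1r.
by apply: (le_trans (ler_normD _ _)); rewrite lerD.
Qed.

(** A path without repeated vertices has fewer than [#|vert G|] edges. *)
Lemma connected_variation f (Y : R) u v : 0 <= Y ->
  (forall e, `|f (tgt e) - f (src e)| <= Y) -> `|f v - f u| <= #|vert G|%:R * Y.
Proof.
move=> Y0 hY; have [_ /(_ u v)/connectP[p pp ->]] := wgraph_connected G.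
have [p' pp' up' _] := shortenP pp.
apply: (le_trans (path_variation hY pp')); rewrite ler_wpM2r// ler_nat.
by apply: ltnW; rewrite -[leqLHS]/(size (u :: p')) -(card_uniqP up') max_card.
Qed.

Lemma energy0 D : energy D (fun=> 0) = 0.
Proof.
rewrite /energy !big1 ?subrr// => i _; first by rewrite mulr0.
by rewrite /slope subrr mul0r psi0 mulr0 addr0 mul0r addr0.
Qed.

(** Slopes ignore [k], and the degree hypothesis makes the two linear terms change by the same
    [#|edge G| * k]. *)
Lemma energy_shift D f k : \sum_v D v = #|edge G|%:Z - #|vert G|%:Z ->
  energy D (fun v => f v + k) = energy D f.
Proof.
move=> hD; rewrite /energy.
have -> : \sum_e (len e * psi (slope (fun v => f v + k) e) +
      (f (src e) + k + (f (tgt e) + k)) / 2) =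
   \sum_e (len e * psi (slope f e) + (f (src e) + f (tgt e)) / 2) + #|edge G|%:R * k.
  rewrite -[#|edge G|]/#|[pred e : edge G | true]| -sum1_card natr_sum mulr_suml -big_split /=.
  apply: eq_bigr => e _; rewrite /slope mul1r.
  have -> : f (tgt e) + k - (f (src e) + k) = f (tgt e) - f (src e) by ring.
  by field.
have -> : \sum_v (D v + 1)%:~R * (f v + k) =
   \sum_v (D v + 1)%:~R * f v + #|edge G|%:R * k.
  rewrite (eq_bigr (fun v => (D v + 1)%:~R * f v + (D v + 1)%:~R * k)); last first.
    by move=> v _; rewrite mulrDr.
  rewrite big_split /= -mulr_suml -rmorph_sum /= big_split /= hD sumr_const.
  congr (_ + _ * _); rewrite natz.
  exact: (congr1 intr (subrK #|vert G|%:Z #|edge G|%:Z)).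
ring.
Qed.

(** With [f v0 = 0] the values of [f] are bounded by [N * Y], where [Y] is the total variation over
    the edges. The linear terms are then at most [K0 * N * Y] in size, whereas the [psi] terms
    dominate a line in [Y] of larger slope; nonpositive energy thus bounds [Y]. *)
Lemma energy_coercive D : exists B : R, 0 <= B /\
  forall f v0, f v0 = 0 -> energy D f <= 0 -> forall v, `|f v| <= B.
Proof.
pose N : R := #|vert G|%:R.
pose K0 : R := #|edge G|%:R + \sum_v `|(D v + 1)%:~R|.
have K00 : 0 <= K0 by rewrite addr_ge0// sumr_ge0.
have N0 : 0 <= N by [].
(* This slope beats [K0 * N] by at least 1, so that the final inequality yields [Y <= C]. *)
pose n : nat := (Num.truncn (K0 * N + 1)).+1.
have nK : K0 * N + 1 <= n%:R by apply/ltW; exact: truncnS_gt.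
pose C : R := \sum_(e : edge G) len e * (n%:R * (n%:R + 1) / 2).
have C0 : 0 <= C.
  by apply: sumr_ge0 => e _; rewrite !mulr_ge0 ?addr_ge0 ?invr_ge0 ?(ltW (len_gt0 _))//.
exists (N * C); split=> [|f v0 fv0 fE v]; first exact: mulr_ge0.
pose Y : R := \sum_e `|f (tgt e) - f (src e)|.
have Y0 : 0 <= Y by exact: sumr_ge0.
have hY e : `|f (tgt e) - f (src e)| <= Y.
  by rewrite /Y (bigD1 e)//= lerDl sumr_ge0.
have fY u : `|f u| <= N * Y.
  by have := @connected_variation f Y v0 u Y0 hY; rewrite fv0 subr0.
suff YC : Y <= C by apply: (le_trans (fY v)); exact: ler_wpM2l.
have low : (n%:R + 2^-1) * Y - C <= \sum_e len e * psi (slope f e).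
  rewrite mulr_sumr -sumrB; apply: ler_sum => e _.
  have l0 := len_gt0 e.
  have h := psi_ge_norm n (slope f e); rewrite -(ler_pM2l l0) in h.
  apply: le_trans h.
  rewrite /slope normrM normfV (gtr0_norm l0) mulrBr lerD2r.
  by rewrite mulrCA [len e * _]mulrC divfK ?gt_eqF.
have up1 : - \sum_e ((f (src e) + f (tgt e)) / 2) <= #|edge G|%:R * (N * Y).
  rewrite -sumrN -[#|edge G|]/#|[pred e : edge G | true]| -sum1_card natr_sum mulr_suml.
  apply: ler_sum => e _; rewrite mul1r.
  by have := fY (src e); have := fY (tgt e); rewrite !ler_norml; lra.
have up2 : \sum_v (D v + 1)%:~R * f v <= (\sum_v `|(D v + 1)%:~R|) * (N * Y).
  rewrite mulr_suml; apply: ler_sum => u _; apply: (le_trans (ler_norm _)).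
  by rewrite normrM ler_wpM2l.
move: fE; rewrite /energy big_split /= => fE.
have : (n%:R + 2^-1) * Y - C <= K0 * N * Y by rewrite /K0; lra.
by nra.
Qed.

Lemma energy_continuous D (X : topologicalType) (h : X -> vert G -> R) :
  (forall v, continuous (fun x => h x v)) -> continuous (fun x => energy D (h x)).
Proof.
move=> ch x.
have hsl e : (slope (h y) e @[y --> x] --> slope (h x) e)%classic.
  by apply: cvgMl; apply: cvgB; exact: ch.
rewrite /energy; apply: cvgB.
  apply: cvg_big => [|e _]; first exact: add_continuous.
  apply: cvgD; last by apply: cvgMl; apply: cvgD; exact: ch.
  apply: cvgMr; apply: (cvg_comp _ _ (hsl e)); exact: psi_continuous.
apply: cvg_big => [|v _]; first exact: add_continuous.
by apply: cvgMr; exact: ch.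
Qed.

(** Shift invariance normalizes a competitor to vanish at [v0], and one of positive energy loses to
    0; coercivity confines the rest to a compact box. *)
Lemma energy_min D : \sum_v D v = #|edge G|%:Z - #|vert G|%:Z ->
  exists f, forall h, energy D f <= energy D h.
Proof.
move=> hD; have [/card_gt0P[v0 _] _] := wgraph_connected G.
have [B [B0 hB]] := energy_coercive D.
pose X := prod_topology (fun _ : vert G => R).
pose box := [set f : X | forall v, `[(- B), B]%classic (f v)]%classic.
have cbox : compact box.
  apply: (@tychonoff _ (fun _ : vert G => R) (fun=> `[(- B), B]%classic)) => v.
  exact: segment_compact.
have box0 : box (fun=> 0) by move=> v /=; rewrite in_itv /= oppr_le0 B0.
have [||f _ fmin] := @compact_EVT_min X R (energy D) box _ cbox.
- by exists (fun=> 0).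
- apply: continuous_subspaceT.
  apply: (@energy_continuous D X (fun f => f)) => v.
  exact: (@proj_continuous _ (fun _ : vert G => R) v).
exists f => h.
have [hE|/ltW hE] := leP (energy D h) 0; last first.
  by apply: le_trans hE; rewrite -(energy0 D); apply: fmin; rewrite inE.
rewrite -(energy_shift h (- h v0) hD); apply: fmin; rewrite inE => v /=.
rewrite in_itv /= -ler_norml.
by apply: (hB (fun v => h v - h v0) v0); rewrite ?subrr// energy_shift.
Qed.

End Energy.

Lemma exists_pos_lbound (R : realType) (I : finType) (d : I -> R) :
  (forall i, 0 < d i) -> exists2 eps, 0 < eps & forall i, eps <= d i.
Proof.
move=> d0; exists (\big[Order.min/1]_i d i); last by move=> i; exact: bigmin_le.
by apply: lt_bigmin.
Qed.

(** The floors of the slopes leaving the two ends of an edge add up to 0 on an integral edge and to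
    -1 on any other, whose missing chip sits at the break. *)
Lemma floorD_floorN (R : realType) (x : R) :
  Num.floor x + Num.floor (- x) = (x \is a Num.int)%:R - 1.
Proof.
have := ceil_floor x; rewrite ceilNfloor.
by move: (Num.floor x) (Num.floor (- x)) => a b; case: (x \is a Num.int) => /=; lia.
Qed.

(** * First variation of the energy along a set of vertices *)

Section Minimizer.
Variables (R : realType) (G : wgraph R) (D : vert G -> int) (f : vert G -> R).
Variable S : {set vert G}.

(** The rate at which the term of [e] in the energy changes when [f] is lowered on [S]: for [src e]
    alone in [S] it is [(floor + 1/2) - 1/2]; for both ends in [S] only the linear part moves. *)
Definition cut_weight (e : edge G) : int :=
  if src e \in S then (if tgt e \in S then -1 else Num.floor (slope f e))
  else (if tgt e \in S then Num.floor (- slope f e) else 0).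

(** An edge with both ends in [S] contributes its two floors, that is -1, plus 1 when integral; a
    cut edge contributes the floor at its end in [S]. *)
Lemma fired_cut : \sum_(v in S) fired D f v =
  #|inner (integral_edges f) S|%:Z + (\sum_e cut_weight e + \sum_(v in S) (D v + 1)).
Proof.
have exch (F : edge G -> int) (s : edge G -> vert G) :
    \sum_(v in S) \sum_(e | s e == v) F e = \sum_e (if s e \in S then F e else 0).
  rewrite -big_mkcond (partition_big s (mem S))//=; apply: eq_bigr => v vS.
  by apply: eq_bigl => e; case: eqP => [->|]; rewrite ?vS ?andbF.
rewrite /fired 2!big_split /= !exch innerE [X in _ = X + _]big_mkcond /=.
rewrite -addrA [LHS]addrC addrA; congr (_ + _); rewrite -!big_split /=.
apply: eq_bigr => e _; rewrite inE /cut_weight.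
have := floorD_floorN (slope f e).
by do 2 case: (_ \in S); case: (slope f e \is a Num.int) => /=; lia.
Qed.

(** Until a slope reaches the next integer, [psi] is affine along the move, so the first variation
    is an exact equality. *)
Lemma energy_cut : exists2 eps : R, 0 < eps &
  energy D (fun v => f v - eps * (v \in S)%:R) =
  energy D f + eps * (\sum_e cut_weight e + \sum_(v in S) (D v + 1))%:~R.
Proof.
(* [d] is the largest step before the slope of the edge, seen from its source ([true]) or its target
   ([false]), reaches the next integer above. *)
pose d (eb : edge G * bool) := if eb.2 then
  len eb.1 * ((Num.floor (slope f eb.1))%:~R + 1 - slope f eb.1) else
  len eb.1 * ((Num.floor (- slope f eb.1))%:~R + 1 + slope f eb.1).
have [[e b]|eps eps0 heps] := @exists_pos_lbound R _ d.
  have flo (x : R) : 0 < (Num.floor x)%:~R + 1 - x.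
    by have /andP[_] := floor_itv x; rewrite rmorphD /= subr_gt0.
  by rewrite /d /=; case: b; rewrite mulr_gt0 ?len_gt0//;
    have := flo (- slope f e); rewrite opprK.
exists eps => //; rewrite /energy.
have -> : \sum_v (D v + 1)%:~R * (f v - eps * (v \in S)%:R) =
   \sum_v (D v + 1)%:~R * f v - eps * (\sum_(v in S) (D v + 1))%:~R.
  rewrite rmorph_sum /= [X in eps * X]big_mkcond /= mulr_sumr -sumrB.
  by apply: eq_bigr => v _; case: (v \in S) => /=; rewrite ?mulr1 ?mulr0; ring.
set EN := (X in X - _ = _).
suff -> : EN = \sum_e (len e * psi (slope f e) + (f (src e) + f (tgt e)) / 2) +
    eps * (\sum_e cut_weight e)%:~R by rewrite rmorphD /=; ring.
rewrite {}/EN rmorph_sum /= mulr_sumr -big_split /=; apply: eq_bigr => e _.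
have l0 := len_gt0 e; have ln0 : len e != 0 by rewrite gt_eqF.
have := heps (e, true); have := heps (e, false); rewrite /d /= => hm hp.
rewrite /cut_weight; set a := slope f e in hm hp *.
set a' := slope _ e.
have a'E : a' = a + eps / len e * ((src e \in S)%:R - (tgt e \in S)%:R).
  by rewrite /a' /a /slope; field.
case: (src e \in S) a'E; case: (tgt e \in S) => /=;
  rewrite ?subrr ?subr0 ?sub0r ?mulr0 ?mulr1 ?addr0 ?mulrN1 => ->.
- by field.
- rewrite psiD; first by field.
    by rewrite ltW// divr_gt0.
  by rewrite -lerBrDl ler_pdivrMr// mulrC.
- rewrite -psiN opprD opprK psiD ?psiN; first by field.
    by rewrite ltW// divr_gt0.
  by rewrite -lerBrDl ler_pdivrMr// mulrC opprK.
- by ring.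
Qed.

End Minimizer.

(** Minimality makes the exact first variation nonnegative for every [S]. *)
Lemma energy_min_hakimi (R : realType) (G : wgraph R) D (f : vert G -> R) :
  (forall h, energy D f <= energy D h) -> hakimi (fired D f) (integral_edges f).
Proof.
move=> fmin S; rewrite (fired_cut D f S).
have [eps eps0 epsE] := energy_cut D f S.
have := fmin (fun v => f v - eps * (v \in S)%:R).
by rewrite epsE lerDl pmulr_rge0// ler0z lerDl.
Qed.

(** * Bisection of the edges of a model *)

Section Glue.
Variables (R : realType) (T : metricType R) (G : model T).

Lemma glue_function (X : Type) (w : vert G -> X) (phi : edge G -> R -> X) :
  (forall e, phi e 0 = w (src e)) -> (forall e, phi e (len e) = w (tgt e)) ->
  exists F : T -> X, (forall v, F (pt v) = w v) /\
    forall e t, 0 <= t <= len e -> F (seg e t) = phi e t.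
Proof.
move=> phi0 phil.
have interior e t : 0 <= t <= len e -> [\/ t = 0, t = len e | 0 < t < len e].
  rewrite !le_eqVlt => /andP[/orP[/eqP<-|t0]]; first by constructor 1.
  by move=> /orP[/eqP->|tl]; [constructor 2 | constructor 3; rewrite t0].
(* Requiring agreement with every representation of [x] at once makes the chosen function satisfy
   both conclusions. *)
have /choice[F hF] : forall x : T, exists y, (forall v, pt v = x -> y = w v) /\
    (forall e t, 0 <= t <= len e -> seg e t = x -> y = phi e t).
  move=> x; have [[v vx]|[e [t [te tx]]]] := model_cover G x.
    exists (w v); split=> [u|e t].
      by rewrite -vx => /pt_inj ->.
    move=> /interior[->|->|te]; last by rewrite -vx => /(@seg_vert _ _ G _ _ v te).
      by rewrite seg_src -vx => /pt_inj <-.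
    by rewrite seg_tgt -vx => /pt_inj <-.
  exists (phi e t); split=> [v|e' t']; first by rewrite -tx => /esym/(@seg_vert _ _ G _ _ v te).
  move=> /interior[->|->|te'].
  - by rewrite seg_src -tx => /esym/(@seg_vert _ _ G _ _ _ te).
  - by rewrite seg_tgt -tx => /esym/(@seg_vert _ _ G _ _ _ te).
  - by rewrite -tx => /(seg_inj te' te)[-> ->].
exists F; split=> [v|e t te]; first exact: (hF (pt v)).1.
exact: (hF (seg e t)).2.
Qed.

End Glue.

Section ChainLemmas.
Variables (R : realType) (G : wgraph R) (T : Type) (sg : edge G -> R -> T).

Lemma chain_cat x y z w w' :
  chain sg x w y -> chain sg y w' z -> chain sg x (w ++ w') z.
Proof.
elim: w x => [|[[e s] t] w IH] x /=; first by move=> ->.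
by move=> [? ? ? /IH h] /h.
Qed.

Lemma chain_length_cat (w w' : seq (edge G * R * R)) :
  chain_length (w ++ w') = chain_length w + chain_length w'.
Proof. exact: big_cat. Qed.

Lemma chain_length_ge0 (w : seq (edge G * R * R)) : 0 <= chain_length w.
Proof. exact: sumr_ge0. Qed.

End ChainLemmas.

Section Bisection.
Variables (R : realType) (T : metricType R) (G : model T) (tau : edge G -> R).
Hypothesis tau_itv : forall e, 0 < tau e < len e.

(* Each edge [e] is cut at the parameter [tau e]; [(e, false)] and [(e, true)]
   are its halves at [src e] and at [tgt e]. *)
Definition bis_graph : fgraph :=
  @FGraph (vert G + edge G)%type (edge G * bool)%type
    (fun eb => if eb.2 then inr eb.1 else inl (src eb.1))
    (fun eb => if eb.2 then inl (tgt eb.1) else inr eb.1).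

Definition bis_len (eb : edge bis_graph) : R :=
  if eb.2 then len eb.1 - tau eb.1 else tau eb.1.

Definition bis_off (eb : edge bis_graph) : R := if eb.2 then tau eb.1 else 0.

Definition bis_pt (v : vert bis_graph) : T :=
  match v with inl u => pt u | inr e => seg e (tau e) end.

Definition bis_seg (eb : edge bis_graph) (t : R) : T := seg eb.1 (bis_off eb + t).

Lemma bis_connected : connected_graph bis_graph.
Proof.
have [/card_gt0P[v0 _] conn] := wgraph_connected G.
split; first by apply/card_gt0P; exists (inl v0).
have adjC : connect_sym (@adj bis_graph).
  by apply: sym_connect_sym => u v; apply: eq_existsb => e; rewrite orbC.
have left e : connect (@adj bis_graph) (inl (src e)) (inr e).
  by apply: connect1; apply/existsP; exists (e, false); rewrite /= !eqxx.
have right e : connect (@adj bis_graph) (inr e) (inl (tgt e)).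
  by apply: connect1; apply/existsP; exists (e, true); rewrite /= !eqxx.
have old u v : connect (@adj bis_graph) (inl u) (inl v).
  have /connectP[p pp ->] := conn u v.
  elim: p u pp => [|w p IH] u //= /andP[uw /IH]; apply: connect_trans.
  case/existsP: uw => e /orP[] /andP[/eqP <- /eqP <-].
    exact: connect_trans (left e) (right e).
  by rewrite adjC; exact: connect_trans (left e) (right e).
move=> [u|e] [v|e']; first exact: old.
- by rewrite adjC; apply: connect_trans (right e') (old _ _).
- exact: connect_trans (right e) (old _ _).
- by apply: connect_trans (right e) (connect_trans (old _ _) (left e')).
Qed.

Lemma bis_loopless (e : edge bis_graph) : src e != tgt e.
Proof. by case: e => e []. Qed.

Lemma bis_len_gt0 (e : edge bis_graph) : 0 < bis_len e.
Proof.
by case: e => e [] /=; have /andP[? ?] := tau_itv e; rewrite /bis_len /= ?subr_gt0.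
Qed.

Definition bis_wgraph : wgraph R := WGraph bis_connected bis_loopless bis_len_gt0.

Lemma bis_open (eb : edge bis_graph) t : 0 < t < bis_len eb ->
  0 < bis_off eb + t < len eb.1 /\ bis_off eb + t != tau eb.1.
Proof.
case: eb => e b; rewrite /bis_len /bis_off /=.
have := tau_itv e; case: b => /= h1 h2; rewrite ?add0r.
  by split; [lra | rewrite gt_eqF//; lra].
by split; [lra | rewrite lt_eqF//; lra].
Qed.

Lemma bis_closed (eb : edge bis_graph) t : 0 <= t <= bis_len eb ->
  0 <= bis_off eb + t <= len eb.1.
Proof.
by case: eb => e []; have := tau_itv e; rewrite /bis_len /bis_off /=; lra.
Qed.

Lemma bis_pt_inj : injective bis_pt.
Proof.
move=> [u|e] [v|e'] /=.
- by move/pt_inj->.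
- by move/esym/(seg_vert (tau_itv _)).
- by move/(seg_vert (tau_itv _)).
- by move/(seg_inj (tau_itv _) (tau_itv _)) => [->].
Qed.

Lemma bis_seg_src e : bis_seg e 0 = bis_pt (src e).
Proof. by case: e => e []; rewrite /bis_seg /bis_off /= ?addr0// seg_src. Qed.

Lemma bis_seg_tgt e : bis_seg e (bis_len e) = bis_pt (tgt e).
Proof.
by case: e => e []; rewrite /bis_seg /bis_off /bis_len /= ?add0r// subrKC seg_tgt.
Qed.

Lemma bis_seg_vert e t v : 0 < t < bis_len e -> bis_seg e t <> bis_pt v.
Proof.
move=> /bis_open[h1 h2]; case: v => [v|e'] /=; first exact: seg_vert.
by move=> /(seg_inj h1 (tau_itv _))[ee /eqP]; rewrite -ee (negPf h2).
Qed.

Lemma bis_seg_inj e t e' t' : 0 < t < bis_len e -> 0 < t' < bis_len e' ->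
  bis_seg e t = bis_seg e' t' -> e = e' /\ t = t'.
Proof.
move=> h h'; have [h1 _] := bis_open h; have [h1' _] := bis_open h'.
move/(seg_inj h1 h1') => []; move: h h' {h1 h1'}.
case: e e' => e b [e' b']; rewrite /bis_off /bis_len /= => + + ee; rewrite -{}ee.
by case: b b' => [] [] /= h h' E; first [by exfalso; lra | by split=> //; lra].
Qed.

Lemma bis_cover x : (exists v, bis_pt v = x) \/
  (exists e t, 0 < t < bis_len e /\ bis_seg e t = x).
Proof.
have [[v <-]|[e [t [te <-]]]] := model_cover G x; first by left; exists (inl v).
case: (ltgtP t (tau e)) => tt.
- right; exists (e, false), t; rewrite /bis_seg /bis_off /bis_len /= add0r; split=> //; lra.
- right; exists (e, true), (t - tau e); rewrite /bis_seg /bis_off /bis_len /= subrKC.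
  by split=> //; lra.
- by left; exists (inr e) => /=; rewrite tt.
Qed.

Lemma chain_of_bis x (w : seq (edge bis_graph * R * R)) y :
  @chain R bis_wgraph T bis_seg x w y ->
  exists2 w', chain (@seg _ _ G) x w' y & chain_length w' = chain_length (G:=bis_wgraph) w.
Proof.
elim: w x => [|[[e s] t] w IH] x /=.
  by move=> ->; exists [::] => //; rewrite /chain_length !big_nil.
move=> [hs ht sx /IH[w' cw' lw']].
exists ((e.1, bis_off e + s, bis_off e + t) :: w').
  by split=> //; exact: bis_closed.
rewrite /chain_length !big_cons -!/(chain_length _) lw' /=; congr (`|_| + _); ring.
Qed.

(** A link that crosses [tau e] is split there; its two pieces have the same total length. *)
Lemma bis_of_link (e : edge G) s t : 0 <= s <= len e -> 0 <= t <= len e ->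
  exists2 w, @chain R bis_wgraph T bis_seg (seg e s) w (seg e t) &
    chain_length (G:=bis_wgraph) w = `|s - t|.
Proof.
have := tau_itv e => te hs ht.
pose E0 : edge bis_wgraph := (e, false); pose E1 : edge bis_wgraph := (e, true).
have seg0 r : bis_seg E0 r = seg e r by rewrite /bis_seg /bis_off /= add0r.
have seg1 r : bis_seg E1 (r - tau e) = seg e r by rewrite /bis_seg /bis_off /= subrKC.
have segm : bis_seg E1 0 = seg e (tau e) by rewrite /bis_seg /bis_off /= addr0.
have [st|/ltW st] := leP s (tau e); have [tt|/ltW tt] := leP t (tau e).
- exists [:: (E0, s, t)]; last by rewrite /chain_length big_seq1.
  by split; rewrite /= ?seg0 /bis_len //=; lra.
- exists [:: (E0, s, tau e); (E1, 0, t - tau e)].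
    rewrite /= !seg0 seg1 segm.
    by do !split=> //; rewrite /bis_len /=; lra.
  rewrite /chain_length !big_cons big_nil /= !ler0_norm ?addr0; lra.
- exists [:: (E1, s - tau e, 0); (E0, tau e, t)].
    rewrite /= !seg0 seg1 segm.
    by do !split=> //; rewrite /bis_len /=; lra.
  rewrite /chain_length !big_cons big_nil /= !ger0_norm ?addr0; lra.
- exists [:: (E1, s - tau e, t - tau e)].
    by split; rewrite /= ?seg1 /bis_len //=; lra.
  by rewrite /chain_length big_seq1 /=; congr (`|_|); ring.
Qed.

Lemma bis_of_chain x w y : chain (@seg _ _ G) x w y ->
  exists2 w', @chain R bis_wgraph T bis_seg x w' y &
    chain_length (G:=bis_wgraph) w' = chain_length w.
Proof.
elim: w x => [|[[e s] t] w IH] x /=.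
  by move=> ->; exists [::] => //; rewrite /chain_length !big_nil.
move=> [hs ht <- /IH[w' cw' lw']].
have [w0 cw0 lw0] := bis_of_link hs ht.
exists (w0 ++ w'); first exact: chain_cat cw0 cw'.
by rewrite chain_length_cat lw0 lw' /chain_length big_cons.
Qed.

Lemma bis_dist x y : mdist x y = @gluing_dist R bis_wgraph T bis_seg x y.
Proof.
rewrite (model_dist G) /gluing_dist; congr inf; apply/seteqP; split=> r /=.
- by move=> [w /bis_of_chain[w' cw' lw'] <-]; exists w'.
- by move=> [w /chain_of_bis[w' cw' lw'] <-]; exists w'.
Qed.

Definition bisect : model T := @Model R T bis_wgraph bis_pt bis_seg bis_pt_inj
  bis_seg_src bis_seg_tgt bis_seg_vert bis_seg_inj bis_cover bis_dist.

End Bisection.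

(** * Valence and the Euler characteristic *)

Lemma eq_big_support (T : eqType) (X Y : seq T) (h : T -> int) :
  uniq X -> uniq Y -> (forall p, h p != 0 -> (p \in X) = (p \in Y)) ->
  \sum_(p <- X) h p = \sum_(p <- Y) h p.
Proof.
move=> uX uY hXY.
have nz (Z : seq T) : \sum_(p <- Z) h p = \sum_(p <- [seq p <- Z | h p != 0]) h p.
  rewrite big_filter [RHS]big_mkcond /=.
  by apply: eq_bigr => p _; case: eqP.
rewrite nz [RHS]nz; apply: perm_big; apply: uniq_perm; rewrite ?filter_uniq// => p.
by rewrite !mem_filter; case hp: (h p != 0) => //=; exact: hXY.
Qed.

Section Valence.
Variables (R : realType) (T : metricType R).
Implicit Types (G : model T) (p : T).

Definition incident G (v : vert G) : pred (edge G * bool) :=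
  fun d => if d.2 then src d.1 == v else tgt d.1 == v.

(** Handshake: each pair [(e, b)] leaves exactly one vertex. *)
Lemma sum_incident G : (\sum_(v : vert G) #|incident v| = #|edge G| * 2)%N.
Proof.
rewrite -card_bool -card_prod -sum1_card.
rewrite (partition_big (fun d : edge G * bool => if d.2 then src d.1 else tgt d.1) predT)//=.
apply: eq_bigr => v _; rewrite -sum1_card; apply: eq_bigl => -[e b].
by rewrite unfold_in /incident /=; case: b.
Qed.

Lemma mdist_seg_le G (e : edge G) s t : 0 <= s <= len e -> 0 <= t <= len e ->
  mdist (seg e s) (seg e t) <= `|s - t|.
Proof.
move=> hs ht; rewrite (model_dist G) /gluing_dist.
apply: ge_inf; first by exists 0 => _ [w _ <-]; exact: chain_length_ge0.
by exists [:: (e, s, t)] => //=; rewrite /chain_length big_seq1.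
Qed.

(* Without a chain from x to y, the infimum of the empty set is 0 and x = y. *)
Lemma lipschitz_mdist G (F : T -> R) :
  (forall (e : edge G) s t, 0 <= s <= len e -> 0 <= t <= len e ->
     `|F (seg e s) - F (seg e t)| <= `|s - t|) ->
  forall x y, `|F x - F y| <= mdist x y.
Proof.
move=> lipF x y.
have lip_chain w z : chain (@seg _ _ G) z w y -> `|F z - F y| <= chain_length w.
  elim: w z => [|[[e s] t] w IH] z /=.
    by move=> ->; rewrite subrr normr0 chain_length_ge0.
  move=> [hs ht <- /IH h]; rewrite /chain_length big_cons -/(chain_length w).
  rewrite -(subrKA (F (seg e t))); apply: (le_trans (ler_normD _ _)).
  by rewrite lerD// lipF.
have [c0|/set0P c0] := eqVneq ([set w | chain (@seg _ _ G) x w y])%classic set0.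
  have d0 : mdist x y = 0 by rewrite (model_dist G) /gluing_dist c0 image_set0 inf0.
  by rewrite d0 (mdist_positivity _ _ d0) subrr normr0.
rewrite (model_dist G); apply: lb_le_inf.
  by have [w cw] := c0; exists (chain_length w), w.
by move=> _ [w /lip_chain h <-].
Qed.

(** Defined by the metric alone, through the size of small spheres, so that different models can be
    compared. *)
Definition valence p (n : nat) := exists2 r0 : R, 0 < r0 &
  forall r, 0 < r < r0 -> exists s : seq T,
    [/\ uniq s, size s = n & forall x, (x \in s) = (mdist p x == r)].

Lemma valence_unique p m n : valence p m -> valence p n -> m = n.
Proof.
move=> [r1 r10 h1] [r2 r20 h2]; pose r := Num.min r1 r2 / 2.
have m0 : 0 < Num.min r1 r2 by rewrite lt_min r10.
have r0 : 0 < r by rewrite divr_gt0.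
have m1 : Num.min r1 r2 <= r1 by rewrite ge_min lexx.
have m2 : Num.min r1 r2 <= r2 by rewrite ge_min lexx orbT.
have [|s1 [u1 <- e1]] := h1 r; first by rewrite r0 /= /r; lra.
have [|s2 [u2 <- e2]] := h2 r; first by rewrite r0 /= /r; lra.
by apply/perm_size/uniq_perm => // x; rewrite e1 e2.
Qed.

(** One point at distance [r] lies in each incident direction. Segments bound distances from above;
    the bound from below comes from a 1-Lipschitz function [F], the distance to [v] along an edge
    truncated at [r0]. *)
Lemma valence_pt G (v : vert G) : valence (pt v) #|incident v|.
Proof.
have [r0 r00 hr0] := exists_pos_lbound (@len_gt0 _ G).
exists r0 => // r /andP[r_gt0 rr0].
have rl (e : edge G) : 0 < r < len e by rewrite r_gt0 (lt_le_trans rr0).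
(* Every edge has length at least [r0], so the truncated function takes the value [r0] at each
   vertex other than [v], and the pieces glue. *)
pose phi (e : edge G) t := if src e == v then Num.min t r0
  else if tgt e == v then Num.min (len e - t) r0 else r0.
have loopl (e : edge G) : tgt e == v -> (src e == v) = false.
  by move=> /eqP <-; apply/negbTE; exact: wgraph_loopless.
have [||F [Fv Fe]] := @glue_function _ _ G R (fun u => if u == v then 0 else r0) phi.
- move=> e; rewrite /phi; case: ifP => _; first by rewrite min_l// ltW.
  by rewrite subr0 min_r//; case: ifP.
- move=> e; rewrite /phi subrr; case: ifP => [sv|_].
    by rewrite min_r//; case: ifP => // /loopl; rewrite sv.
  by rewrite min_l ?ltW.
have lipF x y : `|F x - F y| <= mdist x y.
  apply: (@lipschitz_mdist G) => e s t hs ht; rewrite !Fe// /phi.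
  have h1 := ler_norm (s - t); have := ler_norm (t - s); rewrite (distrC t s) => h2.
  case: ifP => _; [|case: ifP => _]; last by rewrite subrr normr0.
    by rewrite /Num.min; do 2 case: ifP => ?; rewrite ler_norml; lra.
  by rewrite /Num.min; do 2 case: ifP => ?; rewrite ler_norml; lra.
have ge_F x : F x <= mdist (pt v) x.
  have := lipF (pt v) x; rewrite Fv eqxx sub0r normrN; apply: le_trans; exact: ler_norm.
have dist_src e t : src e = v -> 0 <= t <= len e -> mdist (pt v) (seg e t) <= t.
  move=> <- te; have s0 : 0 <= (0 : R) <= len e by rewrite lexx ltW ?len_gt0.
  rewrite -seg_src; apply: (le_trans (mdist_seg_le s0 te)).
  by rewrite sub0r normrN ger0_norm//; case/andP: te.
have dist_tgt e t : tgt e = v -> 0 <= t <= len e -> mdist (pt v) (seg e t) <= len e - t.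
  move=> <- te; have s0 : 0 <= len e <= len e by rewrite lexx ltW ?len_gt0.
  rewrite -seg_tgt; apply: (le_trans (mdist_seg_le s0 te)).
  by rewrite ger0_norm// subr_ge0; case/andP: te.
pose h (d : edge G * bool) := seg d.1 (if d.2 then r else len d.1 - r).
have hd_itv (d : edge G * bool) : 0 < (if d.2 then r else len d.1 - r) < len d.1.
  by have := rl d.1; case: d.2 => //; lra.
exists [seq h d | d <- enum (incident v)]; split.
- rewrite map_inj_in_uniq ?enum_uniq// => -[e b] [e' b'].
  rewrite !mem_enum !unfold_in /incident /= => ib ib'.
  move=> /(seg_inj (hd_itv (e, b)) (hd_itv (e', b'))) /= [ee _].
  rewrite -{}ee in ib' *; case: b b' ib ib' => [] [] //.
    by move=> sv /loopl; rewrite sv.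
  by move=> /loopl ->.
- by rewrite size_map -cardE.
move=> x; apply/mapP/eqP => [[[e b]]|xr].
  rewrite mem_enum unfold_in /incident => ib ->; apply/eqP; rewrite eq_le.
  have hd := hd_itv (e, b).
  have hd' : 0 <= (if b then r else len e - r) <= len e by case/andP: hd => /ltW-> /ltW->.
  rewrite /h /=; case: b ib hd hd' => /= /eqP ev hd hd'.
    rewrite dist_src//=; apply: le_trans (ge_F _).
    by rewrite Fe// /phi ev eqxx min_l// ltW.
  apply/andP; split; first by have := dist_tgt _ _ ev hd'; rewrite subKr.
  apply: le_trans (ge_F _).
  by rewrite Fe// /phi loopl ev eqxx// subKr min_l// ltW.
(* Conversely, [F x <= r < r0] puts [x] on an edge at [v], where the two bounds force its
   parameter. *)
have Fx : F x < r0 by apply: le_lt_trans rr0; rewrite -xr.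
have [[u ux]|[e [t [te tx]]]] := model_cover G x.
  move: Fx; rewrite -ux Fv; case: eqP => [uv|]; last by rewrite ltxx.
  by move: xr r_gt0; rewrite -ux uv mdistxx => <-; rewrite ltxx.
have te' : 0 <= t <= len e by case/andP: te => /ltW-> /ltW->.
have := ge_F x; rewrite xr.
move: Fx; rewrite -tx Fe// /phi; case: ifP => [/eqP sv|_].
  rewrite gt_min ltxx orbF => tr0; rewrite min_l ?(ltW tr0)// => tr.
  have := dist_src _ _ sv te'; rewrite tx xr => rt.
  exists (e, true); first by rewrite mem_enum unfold_in /incident /= sv.
  by rewrite /h /= -tx; congr seg; apply/eqP; rewrite eq_le tr rt.
case: ifP => [/eqP tv|_]; last by rewrite ltxx.
rewrite gt_min ltxx orbF => tr0; rewrite min_l ?(ltW tr0)// => tr.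
have := dist_tgt _ _ tv te'; rewrite tx xr => rt.
exists (e, false); first by rewrite mem_enum unfold_in /incident /= tv.
by rewrite /h /= -tx; congr seg; lra.
Qed.

End Valence.

Section Refinement.
Variables (R : realType) (T : metricType R).
Implicit Types (G : model T) (p : T).

Lemma midpoint_itv G (e : edge G) : 0 < len e / 2 < len e.
Proof. by have := len_gt0 e; lra. Qed.

(** A bisection cuts every edge, so the edges away from [p] are cut at their midpoints. *)
Lemma bisect_at G p : (forall v : vert G, pt v <> p) ->
  exists (tau : edge G -> R) (tau_itv : forall e, 0 < tau e < len e) (e : edge G),
    pt (inr e : vert (bisect tau_itv)) = p.
Proof.
move=> pv; have [[v /pv]//|[e0 [t0 [te tx]]]] := model_cover G p.
have tau_itv e : 0 < (if e == e0 then t0 else len e / 2) < len e.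
  by case: eqP => [->//|_]; exact: midpoint_itv.
by exists _, tau_itv, e0 => /=; rewrite eqxx.
Qed.

Lemma bisect_incident G tau (tau_itv : forall e : edge G, 0 < tau e < len e) e :
  incident (inr e : vert (bisect tau_itv)) =i
    [pred d | d \in [:: (e, true, true); (e, false, false)]].
Proof.
move=> [[e' b] c]; rewrite !inE !unfold_in /incident /= !xpair_eqE.
by case: b; case: c => /=; rewrite ?andbF ?andbT ?orbF.
Qed.

(** After bisection at [p], it is a vertex at which exactly two half-edges meet. *)
Lemma valence_not_pt G p : (forall v : vert G, pt v <> p) -> valence p 2.
Proof.
move=> /bisect_at[tau [tau_itv [e <-]]].
have := valence_pt (inr e : vert (bisect tau_itv)).
by rewrite (eq_card (@bisect_incident _ _ tau_itv e)) (card_uniqP _)//= inE xpair_eqE andbF.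
Qed.

Lemma uniq_pts G : uniq [seq pt v | v <- enum (vert G)].
Proof. by rewrite map_inj_uniq ?enum_uniq//; exact: pt_inj. Qed.

Lemma mem_pts G p :
  reflect (exists v : vert G, pt v = p) (p \in [seq pt v | v <- enum (vert G)]).
Proof.
apply: (iffP mapP) => [[v _ ->]|[v <-]]; first by exists v.
by exists v; rewrite ?mem_enum.
Qed.

Lemma big_pts G (h : T -> int) :
  \sum_(p <- [seq pt v | v <- enum (vert G)]) h p = \sum_(v : vert G) h (pt v).
Proof. by rewrite big_map big_enum. Qed.

(** Points off the vertices have valence 2 and contribute 0, so any finite list [X] containing the
    vertices gives the same sum, which the handshake formula evaluates. *)
Lemma sum_valence G (val : T -> nat) (X : seq T) : uniq X ->
  (forall p, valence p (val p)) -> (forall v : vert G, pt v \in X) ->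
  \sum_(p <- X) ((val p)%:Z - 2) = (#|edge G|%:Z - #|vert G|%:Z) * 2.
Proof.
move=> uX hval GX; rewrite (eq_big_support uX (uniq_pts G)) ?big_pts; last first.
  move=> p; case: mem_pts => [[v <-] _|np]; first by rewrite GX.
  have p2 : valence p 2 by apply: (@valence_not_pt G) => v vp; apply: np; exists v.
  by rewrite (valence_unique (hval p) p2) subrr eqxx.
rewrite sumrB sumr_const (eq_bigr (fun v => (#|incident v|)%:R)); last first.
  by move=> v _; rewrite natz (valence_unique (hval _) (valence_pt v)).
rewrite -natr_sum sum_incident natz.
by move: #|edge G| #|vert G| => m n; lia.
Qed.

Lemma euler_invariant G1 G2 :
  #|edge G1|%:Z - #|vert G1|%:Z = #|edge G2|%:Z - #|vert G2|%:Z.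
Proof.
have /choice[val hval] : forall p, exists n, valence p n.
  move=> p; have [[v <-]|nv] := pselect (exists v : vert G1, pt v = p).
    by exists #|incident v|; exact: valence_pt.
  by exists 2; apply: (@valence_not_pt G1) => v vp; apply: nv; exists v.
(* One list contains the vertices of both models, and the same sum over it is computed twice. *)
pose X := undup ([seq pt v | v <- enum (vert G1)] ++ [seq pt v | v <- enum (vert G2)]).
have uX : uniq X by exact: undup_uniq.
have X1 (v : vert G1) : pt v \in X.
  by rewrite mem_undup mem_cat; apply/orP; left; apply/mem_pts; exists v.
have X2 (v : vert G2) : pt v \in X.
  by rewrite mem_undup mem_cat; apply/orP; right; apply/mem_pts; exists v.
have := sum_valence uX hval X1; rewrite (sum_valence uX hval X2).
by move: (_ - _) (_ - _) => a b; lia.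
Qed.

(** Bisection keeps the old vertices, so the points of [X] can be made vertices one at a time. *)
Lemma exists_model_with G (X : seq T) :
  exists G' : model T, forall p, p \in X -> exists v : vert G', pt v = p.
Proof.
elim: X => [|p X [G' hG']]; first by exists G.
have [[v vp]|nv] := pselect (exists v : vert G', pt v = p).
  by exists G' => q; rewrite inE => /predU1P[->|/hG']//; exists v.
have [|tau [tau_itv [e ep]]] := @bisect_at G' p.
  by move=> v vp; apply: nv; exists v.
exists (bisect tau_itv) => q; rewrite inE => /predU1P[->|/hG'[v vq]].
  by exists (inr e).
by exists (inl v).
Qed.

End Refinement.

(** * Firing a convex function *)

Lemma exists_oriented_firing (R : realType) (G : wgraph R) (D : vert G -> int) :
  \sum_v D v = #|edge G|%:Z - #|vert G|%:Z ->
  exists (f : vert G -> R) (o : orientation G), forall v,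
    fired D f v = #|[set e in integral_edges f | edge_head o e == v]|%:Z.
Proof.
move=> hD; have [f fmin] := energy_min hD; exists f.
apply: hakimi_orientation; first exact: energy_min_hakimi.
have setT_pred (F : vert G -> int) : \sum_v F v = \sum_(v in [set: vert G]) F v.
  by apply: eq_bigl => v; rewrite inE.
(* For the full vertex set every cut weight is -1 and the sum of [D v + 1] is [#|edge G|], so
   exactly the number of integral edges remains: the total required by Hakimi's theorem. *)
rewrite setT_pred fired_cut -setT_pred big_split /= hD sumr_const natz.
rewrite (_ : inner _ _ = integral_edges f); last first.
  by apply/setP => e; rewrite !inE /= andbT.
rewrite (eq_bigr (fun=> -1)) => [|e _]; last by rewrite /cut_weight !inE.
rewrite sumr_const mulNrn natz.
by move: #|edge G| #|vert G| #|integral_edges f| => a b c; lia.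
Qed.

Lemma big_prod_bool (I : finType) (F : I * bool -> int) :
  \sum_d F d = \sum_i (F (i, true) + F (i, false)).
Proof.
rewrite (eq_bigr (fun d => F (d.1, d.2))) => [|[]//].
rewrite -(pair_bigA _ (fun i b => F (i, b))) /=.
by apply: eq_bigr => i _; rewrite big_bool.
Qed.

(** * Tangent directions, slopes and indegrees on a model *)

Section Tangent.
Variables (R : realType) (Gam : metricGraph R) (G : model Gam).

Lemma tangent_pt (v : vert G) d : tangent (pt v) d = incident v d.
Proof.
case: d => e b; apply/asboolP/idP => [[t /= [/andP[t0 tl] tv tb]]|].
  have [t00|] := eqVneq t 0.
    by move: tv tb; rewrite t00 seg_src /incident => /pt_inj <-; case: b; rewrite //= ltxx.
  move: t0; rewrite le_eqVlt eq_sym => /orP[-> //|t0] _.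
  have [tl0|] := eqVneq t (len e).
    by move: tv tb; rewrite tl0 seg_tgt /incident => /pt_inj <-; case: b; rewrite //= ltxx.
  move: tl; rewrite le_eqVlt => /orP[-> //|tl] _.
  by case: (@seg_vert _ _ G e t v _ tv); rewrite t0.
have l0 := len_gt0 e; rewrite /incident /=; case: b => /eqP <-.
  by exists 0; rewrite lexx (ltW l0) seg_src.
by exists (len e); rewrite lexx (ltW l0) seg_tgt.
Qed.

Lemma tangent_interior (e : edge G) t d : 0 < t < len e ->
  tangent (seg e t) d = (d.1 == e).
Proof.
move=> te; case: d => e' b; apply/asboolP/eqP => [[t' /= [/andP[t0 tl] tv tb]]|/= ->].
  move: t0; rewrite le_eqVlt => /orP[/eqP t0|t0].
    by case: (@seg_vert _ _ G e t (src e') te); rewrite -seg_src t0 tv.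
  move: tl; rewrite le_eqVlt => /orP[/eqP t0'|tl].
    by case: (@seg_vert _ _ G e t (tgt e') te); rewrite -seg_tgt -t0' tv.
  by have [|//] := seg_inj _ te tv; rewrite t0.
by exists t; case/andP: te => t0 tl; rewrite !ltW//; case: b.
Qed.

Lemma sigma_pt (s : edge G -> int) v : sigma s (pt v) =
  - \sum_e ((if src e == v then s e else 0) - (if tgt e == v then s e else 0)).
Proof.
rewrite /sigma; congr (- _).
rewrite big_mkcond big_prod_bool; apply: eq_bigr => e _.
by rewrite !tangent_pt /incident /out_slope /=; do 2 case: ifP => _; rewrite ?oppr0.
Qed.

Lemma sigma_interior (s : edge G -> int) (e : edge G) t : 0 < t < len e ->
  sigma s (seg e t) = 0.
Proof.
move=> te; rewrite /sigma big_mkcond big_prod_bool big1 ?oppr0// => e' _.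
rewrite !tangent_interior// /out_slope /=; case: ifP => _; by rewrite ?subrr ?addr0.
Qed.

Lemma indeg_atE (o : orientation G) p : (indeg_at o p)%:Z =
  \sum_e ((tangent p (e, true) && ~~ o e)%:R + (tangent p (e, false) && o e)%:R).
Proof.
rewrite /indeg_at -sum1_card -natz natr_sum big_mkcond big_prod_bool /=.
apply: eq_bigr => e _; rewrite !inE /=.
by case: (o e); do 2 case: (tangent _ _).
Qed.

Lemma indeg_at_pt (o : orientation G) v : (indeg_at o (pt v))%:Z =
  \sum_e (((src e == v) && ~~ o e)%:R + ((tgt e == v) && o e)%:R).
Proof. by rewrite indeg_atE; apply: eq_bigr => e _; rewrite !tangent_pt. Qed.

Lemma indeg_at_interior (o : orientation G) (e : edge G) t : 0 < t < len e ->
  (indeg_at o (seg e t))%:Z = 1.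
Proof.
move=> te; rewrite indeg_atE (bigD1 e)//= big1 => [|e' e'e].
  by rewrite !tangent_interior// eqxx; case: (o e).
by rewrite !tangent_interior //= (negPf e'e).
Qed.

Lemma deg_model (D : divisor Gam) : model_for G D ->
  deg D = \sum_(v : vert G) D (pt v).
Proof.
move=> GD; rewrite -big_pts; apply: eq_big_support; rewrite ?fset_uniq ?uniq_pts// => p Dp.
rewrite mem_finsupp Dp; apply/esym/mem_pts.
by have [v _ vp] := GD p Dp; exists v.
Qed.

End Tangent.

Lemma inl_eq (A B : eqType) (x y : A) : (inl x == inl y :> A + B) = (x == y).
Proof. by []. Qed.

Lemma inr_eq (A B : eqType) (x y : B) : (inr x == inr y :> A + B) = (x == y).
Proof. by []. Qed.

(** * Convex extension of a vertex function with integer slopes *)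

Section Extension.
Variables (R : realType) (Gam : metricGraph R) (G : model Gam) (f : vert G -> R).
Implicit Types (e : edge G) (v : vert G).

(* For a non-integral mean slope, this is the parameter where the convex
   extension of [f] to [e] passes from slope [floor] to slope [floor + 1]. *)
Definition break e : R := if slope f e \is a Num.int then len e / 2
  else len e * ((Num.floor (slope f e))%:~R + 1 - slope f e).

Lemma break_itv e : 0 < break e < len e.
Proof.
have l0 := len_gt0 e; rewrite /break; case: ifPn => [_|nint]; first exact: midpoint_itv.
have /andP[fl fl1] := floor_itv (slope f e); rewrite rmorphD /= in fl1.
have flt : (Num.floor (slope f e))%:~R < slope f e.
  by rewrite lt_neqAle fl andbT; move: nint; rewrite intrEfloor.
rewrite mulr_gt0 ?subr_gt0//= gtr_pMr//; lra.
Qed.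

Definition break_model : model Gam := bisect break_itv.

Definition break_slope (eb : edge break_model) : int :=
  Num.floor (slope f eb.1) + (eb.2 && (slope f eb.1 \isn't a Num.int))%:R.

Lemma exists_convex_extension : exists F : Gam -> R, affine_on F break_slope.
Proof.
pose w (x : vert break_model) : R := match x with
  | inl v => f v
  | inr e => f (src e) + (Num.floor (slope f e))%:~R * break e end.
pose phi (eb : edge break_model) (t : R) := w (src eb) + (break_slope eb)%:~R * t.
have [||F [_ hF]] := @glue_function _ _ break_model R w phi.
- by move=> e; rewrite /phi mulr0 addr0.
- move=> [e b]; rewrite /phi /break_slope.
  have slopeE : f (tgt e) = f (src e) + len e * slope f e.
    by rewrite /slope mulrC divfK ?gt_eqF ?len_gt0// subrKC.
  case: b => /=; last by rewrite addr0.
  rewrite rmorphD /= /bis_len /= slopeE /break.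
  (* Off the integers, [break e] is the solution [t] of [floor * t + (floor + 1) * (len e - t) =
     slope * len e]; for an integral slope both halves have that slope. *)
  have [/floorK aE|_] := boolP (slope f e \is a Num.int); rewrite /= ?mulr0z ?mulr1z.
    by rewrite aE; field.
  by ring.
exists F => eb t te; have le := len_gt0 eb.
by rewrite !hF ?lexx ?(ltW le)// /phi mulr0 addr0.
Qed.

Lemma sigma_break_old v : - sigma break_slope (pt v) =
  \sum_(e | src e == v) Num.floor (slope f e) +
  \sum_(e | tgt e == v) Num.floor (- slope f e).
Proof.
have := sigma_pt break_slope (inl v : vert break_model) => /= ->; rewrite opprK.
rewrite big_prod_bool [X in _ = X + _]big_mkcond [X in _ = _ + X]big_mkcond -big_split /=.
apply: eq_bigr => e _; rewrite /break_slope /=.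
(* The second half leaves [tgt e] with slope minus the ceiling, which is the floor of
   [- slope f e]. *)
have := floorD_floorN (slope f e).
rewrite !inl_eq.
by case: (src e == v); case: (tgt e == v); case: (slope f e \is a Num.int) => /=; lia.
Qed.

Lemma sigma_break e : - sigma break_slope (seg e (break e)) =
  (slope f e \isn't a Num.int)%:R.
Proof.
have := sigma_pt break_slope (inr e : vert break_model) => /= ->; rewrite opprK.
rewrite big_prod_bool /= (bigD1 e)//= big1 => [|e' e'e].
  rewrite !inr_eq eqxx /break_slope /=; lia.
by rewrite !inr_eq (negPf e'e).
Qed.

Lemma off_break e t : 0 < t < len e -> t != break e ->
  exists (eb : edge break_model) r, 0 < r < len eb /\ seg eb r = seg e t.
Proof.
move=> te tb; have bi := break_itv e.
case: (ltgtP t (break e)) tb => // tb _.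
- exists (e, false), t; rewrite /= /bis_seg /bis_off /bis_len /= add0r; split=> //; lra.
- exists (e, true), (t - break e); rewrite /= /bis_seg /bis_off /bis_len /= subrKC.
  by split=> //; lra.
Qed.

Lemma sigma_off_break e t : 0 < t < len e -> t != break e ->
  sigma break_slope (seg e t) = 0.
Proof. by move=> te /(off_break te)[eb [r [rl <-]]]; exact: sigma_interior. Qed.

End Extension.

Lemma card_sig_pred (I : finType) (P Q : pred I) :
  #|[pred x : {i | P i} | Q (val x)]| = #|[pred i | P i && Q i]|.
Proof.
rewrite -(fintype.card_image val_inj); apply: eq_card => i; rewrite !inE.
apply/fintype.imageP/andP => [[[j Pj] Qj ->]//|[Pi Qi]].
by exists (exist _ i Pi).
Qed.

(** * The fired divisor and its orientations *)

Section Main.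
Variables (R : realType) (Gam : metricGraph R) (G : model Gam) (D : divisor Gam).
Hypothesis GD : model_for G D.

Lemma divisor_interior (e : edge G) t : 0 < t < len e -> D (seg e t) = 0.
Proof.
move=> te; apply/eqP/negPn/negP => /GD[v _ /esym]; exact: seg_vert.
Qed.

Lemma exists_fired_divisor (f : vert G -> R) : exists D' : divisor Gam,
  [/\ lin_equiv D D',
      forall v, D' (pt v) = fired (fun v => D (pt v)) f v - 1,
      forall e, D' (seg e (break f e)) = (slope f e \isn't a Num.int)%:R
    & forall e t, 0 < t < len e -> t != break f e -> D' (seg e t) = 0].
Proof.
pose s := @break_slope _ _ _ f.
(* This finite set suffices as a support because [sigma s] vanishes inside the edges of the broken
   model. *)
pose D' : divisor Gam := [fsfun p in (finsupp D `|`
    [fset p in [seq pt x | x <- enum (vert (break_model f))]])%fset => D p - sigma s p].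
have D'E p : D' p = D p - sigma s p.
  rewrite fsfunE; case: ifPn => //; rewrite !inE negb_or => /andP[].
  rewrite mem_finsupp negbK => /eqP -> np.
  have [[x xp]|[eb [t [te <-]]]] := model_cover (break_model f) p.
    by case/negP: np; apply/mem_pts; exists x.
  by rewrite sigma_interior ?subr0.
exists D'; split.
- have [F hF] := exists_convex_extension f.
  by exists F, (break_model f), s; split=> // p; rewrite D'E subKr.
- by move=> v; rewrite D'E sigma_break_old /fired; ring.
- by move=> e; rewrite D'E sigma_break divisor_interior ?add0r//; exact: break_itv.
- by move=> e t te tb; rewrite D'E sigma_off_break// divisor_interior ?subr0.
Qed.

Hypothesis degD : deg D = #|edge G|%:Z - #|vert G|%:Z.

Lemma exists_orientable_divisor : exists D' : divisor Gam,
  [/\ lin_equiv D D', semi_model G D',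
      orientable_on (del_graph G D') (restr_div G D') & orientable D'].
Proof.
have [|f [o fo]] := @exists_oriented_firing R G (fun v => D (pt v)).
  by rewrite -deg_model.
have [D' [DD' D'v D'b D'0]] := exists_fired_divisor f.
(* [A] is the edge set of [del_graph G D']: a break carries a chip exactly when the mean slope is
   not an integer. *)
pose A := integral_edges f.
have AE e : (e \in A) = (slope f e \is a Num.int) by rewrite inE.
have cutA e : e \in A -> (open_edge e `&` supp D' = set0)%classic.
  move=> eA; apply/seteqP; split=> // x [[t te <-]]; rewrite /supp /=.
  have [->|tb] := eqVneq t (break f e); last by rewrite D'0 ?eqxx.
  by rewrite D'b -AE eA eqxx.
have cutN e : e \notin A -> (open_edge e `&` supp D' = [set seg e (break f e)])%classic.
  move=> eA; apply/seteqP; split=> x.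
    move=> [[t te <-]]; rewrite /supp /=.
    by have [->//|tb] := eqVneq t (break f e); rewrite D'0 ?eqxx.
  move=> /= ->; split; first by exists (break f e) => //; exact: break_itv.
  by rewrite /supp /= D'b -AE eA.
exists D'; split=> //.
- move=> e; have [/cutA|eA] := boolP (e \in A); [by left | right].
  by exists (seg e (break f e)); rewrite cutN//; split=> //; rewrite D'b -AE eA.
- exists (fun e => o (val e)) => v; rewrite /restr_div D'v fo; congr (Posz _ - 1).
  rewrite /indeg (@card_sig_pred _ _ (fun e => edge_head o e == v)).
  apply: eq_card => e; rewrite !inE; congr (_ && _); rewrite -AE.
  apply/idP/asboolP => [/cutA//|]; apply: contraPT => /cutN ->.
  by move=> /seteqP[/(_ (seg e (break f e)) erefl)].
(* Both halves of an integral edge inherit its direction; those of a broken edge point at the break,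
   giving it indegree 2 and adding nothing at the old vertices. *)
pose o' (eb : edge (break_model f)) := if eb.1 \in A then o eb.1 else ~~ eb.2.
exists (break_model f), o' => p.
have [[x <-]|[eb [t [te xE]]]] := model_cover (break_model f) p; last first.
  rewrite -xE indeg_at_interior// subrr.
  by have [h1 h2] := bis_open (@break_itv _ _ _ f) te; exact: D'0.
rewrite indeg_at_pt big_prod_bool; case: x => [v|e] /=.
- rewrite D'v fo; congr (_ - 1); rewrite -sum1_card -natz natr_sum big_mkcond /=.
  apply: eq_bigr => e _; rewrite !inE /o' /edge_head /= !inl_eq -AE.
  by case: (e \in A) => /=; rewrite ?andbF //; case: (o e) => /=; case: eqP; rewrite ?andbF.
- rewrite D'b (bigD1 e)//= big1 => [|e' e'e].
    by rewrite !inr_eq eqxx /o' /= -AE; case: ifP => //= _; case: (o e).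
  by rewrite !inr_eq (negPf e'e).
Qed.

End Main.

Theorem theorem4p14 (R : realType) (Gam : metricGraph R) (g : int)
    (hg : has_genus Gam g) (D : divisor Gam) (hD : deg D = g - 1) :
  (exists D' : divisor Gam, lin_equiv D D' /\ orientable D') /\
  (forall G : model Gam, model_for G D ->
     exists D' : divisor Gam,
       [/\ lin_equiv D D', semi_model G D' &
           orientable_on (del_graph G D') (restr_div G D')]).
Proof.
have [G0 gE] := hg.
have degD (G : model Gam) : deg D = #|edge G|%:Z - #|vert G|%:Z.
  by rewrite hD gE addrK; exact: euler_invariant.
split=> [|G GD]; last first.
  by have [D' []] := exists_orientable_divisor GD (degD G); exists D'.
(* A model containing the support of [D] is obtained by refining [G0]; the invariance of the Euler
   characteristic supplies its degree hypothesis. *)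
have [G hG] := exists_model_with G0 (finsupp D).
have [p Dp|D' []] := @exists_orientable_divisor _ _ G D _ (degD G); last by exists D'.
by have [|v vp] := hG p; [rewrite mem_finsupp | exists v].
Qed.
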